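(* Let $\mathbf{P}=(S,\mathcal{L})$ be the projective space of a vector space $V$ over a field of characteristic different from $2$, let $\varkappa$ be a nondegenerate symplectic quasi-correlation of $\mathbf{P}$, let $\mathfrak{M}=\mathbf{V}_2(\mathbf{P})$ and $\mathcal{H}=\{x+y : x\in S,\ y\in\varkappa(x)\}$, and let $\mathfrak{A}=\mathfrak{M}\setminus\mathcal{H}$. Then the underlying Veronese space $\mathfrak{M}$ can be recovered from its affine reduct $\mathfrak{A}$, i.e. $\mathfrak{M}$ (its points in $\mathcal{H}$ and all its lines, with incidence) is definable in terms of the structure $\mathfrak{A}$.
   Context: The points of $\mathbf{P}$ are the $1$-dimensional subspaces $\langle v\rangle$ of $V$, its lines are the point sets of $2$-dimensional subspaces. A quasi-correlation $\varkappa$ is given by a nonzero reflexive sesquilinear form $\xi$ on $V$ via $\varkappa(\langle v\rangle)=\{\langle u\rangle:\xi(u,v)=0\}$; it is symplectic if $p\in\varkappa(p)$ for all points $p$, and nondegenerate if $\xi$ is nondegenerate. The Veronese space $\mathbf{V}_2(\mathbf{P})$ has as points all multisets $x+y$ ($x,y\in S$, $2x=x+x$) and as lines all $x+L=\{x+y:y\in L\}$ ($x\in S$, $L\in\mathcal{L}$) and $2L=\{2y:y\in L\}$. The set $\mathcal{H}$ is a hyperplane (proper subspace meeting every line) of $\mathfrak{M}$. The affine reduct $\mathfrak{A}=\mathfrak{M}\setminus\mathcal{H}$ has as points the points of $\mathfrak{M}$ not in $\mathcal{H}$, as lines the sets $L\setminus\mathcal{H}$ for lines $L$ of $\mathfrak{M}$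 with $L\not\subseteq\mathcal{H}$, and parallelism $\parallel_{\mathcal{H}}$: $L_1\setminus\mathcal{H}\parallel_{\mathcal{H}}L_2\setminus\mathcal{H}$ iff $L_1\cap\mathcal{H}=L_2\cap\mathcal{H}$. *)

(* Defs.v *)
From HB Require Import structures.
From mathcomp Require Import all_boot all_order all_algebra.
From mathcomp Require Import finmap multiset.
From mathcomp Require Import boolp classical_sets.

Set Implicit Arguments.
Unset Strict Implicit.
Unset Printing Implicit Defensive.

Import GRing.Theory.
Local Open Scope classical_set_scope.
Local Open Scope ring_scope.

(** * Point-line spaces *)

Record pls := Pls {
  points : choiceType;
  lines : set (set points) }.

(** ** The projective space of a vector space (of arbitrary dimension) *)

Section Projective.
Variables (F : fieldType) (V : lmodType F).

Definition span1 (v : V) : set V := [set a *: v | a in [set: F]].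

Definition span2 (u v : V) : set V :=
  [set w | exists a b : F, w = a *: u + b *: v].

Definition independent2 (u v : V) :=
  forall a b : F, a *: u + b *: v = 0 -> a = 0 /\ b = 0.

Definition is_dim1 (U : set V) : bool :=
  `[< exists2 v : V, v != 0 & U = span1 v >].

Definition is_dim2 (W : set V) : Prop :=
  exists u v : V, independent2 u v /\ W = span2 u v.

Definition proj_point : choiceType := {U : set V | is_dim1 U}.

Lemma is_dim1_span1 (v : V) : v != 0 -> is_dim1 (span1 v).
Proof. by move=> v0; apply/asboolP; exists v. Qed.

(* the point <v> *)
Definition pt (v : V) (v0 : v != 0) : proj_point :=
  exist (fun U => is_true (is_dim1 U)) (span1 v) (is_dim1_span1 v0).

Definition proj_space : pls :=
  @Pls proj_point
    [set L | exists2 W, is_dim2 W & L = [set p | sval p `<=` W]].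

End Projective.

(** ** Quasi-correlations *)

Section QuasiCorrelation.
Variables (F : fieldType) (V : lmodType F) (theta : {rmorphism F -> F}).

(* The form is linear in its first argument and theta-semilinear in the
   second one. *)
Implicit Type xi : {bilinear V -> V -> F | *%R & theta \; *%R}.

Definition reflexive_form xi := forall u v, xi u v = 0 -> xi v u = 0.

Definition nonzero_form xi := exists u v, xi u v != 0.

Definition nondegenerate_form xi :=
  forall v, (forall u, xi u v = 0) -> v = 0.

(* kappa <v> = {<u> : xi (u, v) = 0} *)
Definition induced_by xi
    (kappa : points (proj_space V) -> set (points (proj_space V))) :=
  forall (v : V) (v0 : v != 0) (u : V) (u0 : u != 0),
    kappa (pt v0) (pt u0) <-> xi u v = 0.

End QuasiCorrelation.

Definition symplectic (P : pls) (kappa : points P -> set (points P)) :=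
  forall p, kappa p p.

(** ** The Veronese space V_2(P) *)

Section Veronese.
Variable P : pls.

Definition is_msum (m : {mset points P}%mset) : bool :=
  `[< exists x y : points P, m = [mset x; y]%mset >].

Definition veronese_point : choiceType :=
  {m : {mset points P}%mset | is_msum m}.

Lemma is_msum_mset2 (x y : points P) : is_msum [mset x; y]%mset.
Proof. by apply/asboolP; exists x, y. Qed.

(* the multiset x + y *)
Definition msum (x y : points P) : veronese_point :=
  exist (fun m => is_true (is_msum m)) [mset x; y]%mset (is_msum_mset2 x y).

Definition veronese : pls :=
  @Pls veronese_point
    [set K | (exists x, exists2 L, lines L & K = [set msum x y | y in L])
          \/ (exists2 L, lines L & K = [set msum y y | y in L])].

Definition hyperplane_of (kappa : points P -> set (points P)) :
    set (points veronese) :=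
  [set p | exists x y, kappa x y /\ p = msum x y].

End Veronese.

(** ** Affine reducts *)

Record affine_pls := AffinePls {
  apoints : choiceType;
  alines : set (set apoints);
  aparallel : set apoints -> set apoints -> Prop }.

Section AffineReduct.
Variables (M : pls) (H : set (points M)).

Definition affine_point : choiceType := {p : points M | p \notin H}.

(* L \ H, as a set of affine points *)
Definition trace (L : set (points M)) : set affine_point :=
  [set p | L (sval p)].

Definition affine_reduct : affine_pls :=
  @AffinePls affine_point
    [set l | exists2 L, lines L /\ ~ (L `<=` H) & l = trace L]
    (fun l1 l2 => exists L1 L2,
       [/\ lines L1 /\ ~ (L1 `<=` H), lines L2 /\ ~ (L2 `<=` H),
           l1 = trace L1, l2 = trace L2 & L1 `&` H = L2 `&` H]).

End AffineReduct.

(** * First-order definability *)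

(* Two-sorted first-order formulas in the language of incidence and
   parallelism, without parameters; the free point variables are in X, the
   free line variables in Y, and a quantifier binds the variable None. *)
Inductive formula (X Y : Type) : Type :=
| EqP of X & X
| EqL of Y & Y
| Inc of X & Y
| Par of Y & Y
| Not of formula X Y
| And of formula X Y & formula X Y
| ExP of formula (option X) Y
| ExL of formula X (option Y).

Section Semantics.
Variable A : affine_pls.

Definition aline : Type := {l : set (apoints A) | alines l}.

Fixpoint sat (X Y : Type) (phi : formula X Y) :
    (X -> apoints A) -> (Y -> aline) -> Prop :=
  match phi with
  | EqP x x' => fun e _ => e x = e x'
  | EqL y y' => fun _ d => sval (d y) = sval (d y')
  | Inc x y => fun e d => sval (d y) (e x)
  | Par y y' => fun _ d => aparallel (sval (d y)) (sval (d y'))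
  | Not phi => fun e d => ~ sat phi e d
  | And phi psi => fun e d => sat phi e d /\ sat psi e d
  | ExP phi => fun e d => exists p, sat phi (oapp e p) d
  | ExL phi => fun e d => exists l, sat phi e (oapp d l)
  end.

Definition code (n m : nat) : Type := (('I_n -> apoints A) * ('I_m -> aline))%type.

Definition join (X X' T : Type) (e : X -> T) (e' : X' -> T) (i : X + X') : T :=
  match i with inl x => e x | inr x => e' x end.

Definition sat1 n m (phi : formula 'I_n 'I_m) (c : code n m) :=
  sat phi c.1 c.2.

Definition sat2 n m n' m' (phi : formula ('I_n + 'I_n') ('I_m + 'I_m'))
    (c : code n m) (c' : code n' m') :=
  sat phi (join c.1 c'.1) (join c.2 c'.2).

End Semantics.

(* The syntactic part of an interpretation of a point-line space in its affine
   reduct.  The improper points (those on the hyperplane) and all the lines are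
   coded by tuples of affine points and affine lines; the proper points stand
   for themselves. *)
Record scheme := Scheme {
  ip_np : nat; ip_nl : nat;
  ip_dom : formula 'I_ip_np 'I_ip_nl;
  ip_eq : formula ('I_ip_np + 'I_ip_np) ('I_ip_nl + 'I_ip_nl);
  ln_np : nat; ln_nl : nat;
  ln_dom : formula 'I_ln_np 'I_ln_nl;
  ln_eq : formula ('I_ln_np + 'I_ln_np) ('I_ln_nl + 'I_ln_nl);
  (* incidence of a proper point (the variable None) with a line *)
  proper_inc : formula (option 'I_ln_np) 'I_ln_nl;
  (* incidence of an improper point with a line *)
  improper_inc : formula ('I_ip_np + 'I_ln_np) ('I_ip_nl + 'I_ln_nl) }.

Section Recovery.
Variables (M : pls) (H : set (points M)).
Let A := affine_reduct H.

(* s is an interpretation of M in A, in the usual model-theoretic sense (with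
   coordinate maps f and g), that extends the identity on the points of A. *)
Definition recovers (s : scheme) : Prop :=
  exists (f : code A (ip_np s) (ip_nl s) -> points M)
         (g : code A (ln_np s) (ln_nl s) -> set (points M)),
  [/\ f @` [set c | sat1 (ip_dom s) c] = H,
      g @` [set d | sat1 (ln_dom s) d] = @lines M,
      (forall c c', sat1 (ip_dom s) c -> sat1 (ip_dom s) c' ->
         f c = f c' <-> sat2 (ip_eq s) c c') /\
      (forall d d', sat1 (ln_dom s) d -> sat1 (ln_dom s) d' ->
         g d = g d' <-> sat2 (ln_eq s) d d'),
      (forall (p : apoints A) d, sat1 (ln_dom s) d ->
         g d (sval p) <-> sat (proper_inc s) (oapp d.1 p) d.2) &
      (forall c d, sat1 (ip_dom s) c -> sat1 (ln_dom s) d ->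
         g d (f c) <-> sat2 (improper_inc s) c d)].

Definition definable_in_affine_reduct : Prop := exists s, recovers s.

End Recovery.

(* Main.v *)
(* Write a^ for kappa(a).  Every affine line is the trace of some x + L with L
   not contained in x^, since the lines 2L lie in H; call x its leaf.  Lines of
   P have at least four points, so two affine lines have the same leaf iff each
   point of the first lies on a common affine line with each point of the
   second.  Hence the points of P are the affine lines up to a definable
   equivalence.  Distinct x and y are non-orthogonal iff the point x + y is
   affine, that is, iff some affine point lies on lines with leaves x and y; and
   by nondegeneracy the line of P through x and y is {z : x^ and y^ meet inside
   z^}.  So (S, L, kappa), and with it M and H, is interpretable in A. *)
Require Import Defs.
From mathcomp Require Import all_boot all_order all_algebra.
From mathcomp Require Import finmap multiset.
From mathcomp Require Import boolp classical_sets.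

Set Implicit Arguments.
Unset Strict Implicit.
Unset Printing Implicit Defensive.

Import GRing.Theory.
Local Open Scope classical_set_scope.
Local Open Scope ring_scope.

(** * First-order formulas about the leaves of affine lines *)

Section Formulas.
Variables X Y : Type.

Definition Or (phi psi : formula X Y) := Not (And (Not phi) (Not psi)).
Definition Imp (phi psi : formula X Y) := Not (And phi (Not psi)).
Definition Iff phi psi := And (Imp phi psi) (Imp psi phi).
Definition AllL (phi : formula X (option Y)) := Not (ExL (Not phi)).

Variable A : affine_pls.
Implicit Types (e : X -> apoints A) (d : Y -> aline A).

Lemma sat_Not phi e d : sat (Not phi) e d = ~ sat phi e d.
Proof. by []. Qed.

Lemma sat_And phi psi e d : sat (And phi psi) e d = (sat phi e d /\ sat psi e d).
Proof. by []. Qed.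

Lemma sat_Or phi psi e d : sat (Or phi psi) e d <-> sat phi e d \/ sat psi e d.
Proof. by rewrite /= -not_orE; split=> [/contrapT|h []]. Qed.

Lemma sat_Imp phi psi e d :
  sat (Imp phi psi) e d <-> (sat phi e d -> sat psi e d).
Proof.
split=> [/= h p|h /= [/h]//].
by apply: contrapT => np; apply: h.
Qed.

Lemma sat_Iff phi psi e d :
  sat (Iff phi psi) e d <-> (sat phi e d <-> sat psi e d).
Proof. by split=> [[/sat_Imp ? /sat_Imp]|[? ?]]; last split; try apply/sat_Imp. Qed.

Lemma sat_AllL phi e d :
  sat (AllL phi) e d <-> forall l, sat phi e (oapp d l).
Proof.
split=> [/= h l|h /= [l]]; last by apply; apply: h.
by apply: contrapT => nl; apply: h; exists l.
Qed.

Lemma sat_ExL phi e d (Q : aline A -> Prop) :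
  (forall l, Q l <-> sat phi e (oapp d l)) ->
  (exists l, Q l) <-> sat (ExL phi) e d.
Proof. by move=> h; split=> -[l /h]; exists l. Qed.

Definition sameleaf (y z : Y) : formula X Y :=
  Not (ExP (ExP (And (And (Inc (Some None) y) (Inc None z))
    (Not (ExL (And (Inc (Some None) None) (Inc None None))))))).

End Formulas.

Arguments sameleaf {X Y} y z.

(** Orthogonality of leaves. The clause that the leaves differ makes [perp y y] true, as a
    symplectic [kappa] demands; without it any affine point of [y] would refute it. *)
Definition perp {X Y} (y z : Y) : formula X Y :=
  Not (ExP (ExL (ExL (And
    (And (Inc None (Some None)) (Inc None None))
    (And (And (sameleaf (Some None) (Some (Some y)))
              (sameleaf None (Some (Some z))))
         (Not (sameleaf (Some (Some y)) (Some (Some z))))))))).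

(** Double perp of two leaves; the quantified affine line stands for an arbitrary point of P, namely
    its leaf. *)
Definition inhull {X Y} (y1 y2 y : Y) : formula X Y :=
  AllL (Imp (And (perp (Some y1) None) (perp (Some y2) None))
            (perp (Some y) None)).

(** Incidence of the sum of the leaves of [a] and [b] with the line coded as in [decode_line]. Sums
    are unordered, so on a line [x + L] either summand may be [x]. *)
Definition oncode {X Y} (a b k0 k1 k2 k3 : Y) : formula X Y :=
  Or (And (sameleaf k0 k3)
          (Or (And (sameleaf a k0) (inhull k1 k2 b))
              (And (sameleaf b k0) (inhull k1 k2 a))))
     (And (Not (sameleaf k0 k3))
          (And (sameleaf a b) (inhull k1 k2 a))).

Lemma msumC (P : pls) (x y : points P) : msum x y = msum y x.
Proof. by apply: val_inj; rewrite /= msetDC. Qed.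

Lemma msum_inj (P : pls) (x y z t : points P) :
  msum x y = msum z t <-> (x = z /\ y = t) \/ (x = t /\ y = z).
Proof.
split; last by case=> [[-> ->]//|[-> ->]]; apply: msumC.
have cancel1 a b c : msum a b = msum a c :> veronese_point P -> b = c.
  move=> /(congr1 val)/= /(congr1 (fun m => (m `\` [mset a])%mset)).
  rewrite !(msetDC [mset a]%mset) !msetDKBC => h.
  by have := mset11 b; rewrite h => /mset1P.
move=> e; have := mset21 x y; have /= -> := congr1 val e.
case/mset2P => xe; move: e; rewrite xe => e; [left|right]; split=> //.
  exact: cancel1 e.
by apply: (cancel1 t); rewrite e msumC.
Qed.

(** * Recovery for a symplectic polarity whose double perps are the lines *)

Section Geometry.
Variables (P : pls) (kappa : points P -> set (points P)).
Implicit Types (x y z u w : points P) (L : set (points P)).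

(** The double perp of [x] and [y]. *)
Definition hull x y : set (points P) :=
  [set z | forall w, kappa x w -> kappa y w -> kappa z w].

Lemma hull_l x y : hull x y x. Proof. by move=> w. Qed.
Lemma hull_r x y : hull x y y. Proof. by move=> w. Qed.
Arguments hull_l : clear implicits.
Arguments hull_r : clear implicits.

(** These properties are all that the recovery uses of the projective space and of the form. *)
Hypothesis kappaxx : symplectic kappa.
Hypothesis kappaC : forall x y, kappa x y -> kappa y x.
Hypothesis kappa_proper : forall x, exists y, ~ kappa x y.
Hypothesis linesE : forall L, lines L <-> exists x y, x <> y /\ L = hull x y.
Hypothesis line_avoid : forall L x u a b, lines L -> L u -> ~ kappa x u ->
  exists w, [/\ L w, ~ kappa x w, w <> a & w <> b].

Let M := veronese P.
Let H : set (points M) := hyperplane_of kappa.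
Let A := affine_reduct H.

Lemma msum_hyperplane x y : H (msum x y) <-> kappa x y.
Proof.
split=> [[u [w [k /msum_inj[[-> ->]//|[-> ->]]]]]|k]; first exact: kappaC.
by exists x, y.
Qed.

Lemma msum_affine x y : ~ kappa x y -> exists p : apoints A, sval p = msum x y.
Proof.
move=> k; have h : msum x y \notin H by apply/negP => /set_mem/msum_hyperplane.
by exists (exist (fun p : points M => is_true (p \notin H)) _ h).
Qed.

Lemma affine_msum (p : apoints A) x y : sval p = msum x y -> ~ kappa x y.
Proof.
case: p => p /= /negP pH e k; apply: pH; rewrite e; apply: mem_set.
exact/msum_hyperplane.
Qed.

(** The witness [u] provides an affine point [x + u]. This is a relation because uniqueness of the
    leaf only comes with [has_leafE]. *)
Definition has_leaf (l : aline A) x := exists L u,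
  [/\ lines L, L u, ~ kappa x u &
      forall p, sval l p <-> exists2 w, L w & sval p = msum x w].

Lemma has_leaf_ex (l : aline A) : exists x, has_leaf l x.
Proof.
case: l => l al; have [K [[[x [L lL KE]]|[L lL KE]] KH] le] := al.
- exists x.
  have [p Kp pH] : exists2 p, K p & ~ H p.
    apply: contrapT => h; apply: KH => p Kp.
    by apply: contrapT => np; apply: h; exists p.
  move: (Kp); rewrite KE => -[u Lu pe].
  exists L, u; split=> //.
    by move=> k; apply: pH; rewrite -pe; apply/msum_hyperplane.
  move=> q; rewrite /= le /trace /= KE.
  by split=> -[w Lw e]; exists w.
- case: KH => p; rewrite KE => -[y _ <-]; apply/msum_hyperplane.
  exact: kappaxx.
Qed.

Definition leaf (l : aline A) : points P := projT1 (cid (has_leaf_ex l)).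

Lemma leafP l : has_leaf l (leaf l).
Proof. exact: (projT2 (cid (has_leaf_ex l))). Qed.

Lemma make_line x L u : lines L -> L u -> ~ kappa x u ->
  exists l : aline A, has_leaf l x /\
    forall p, sval l p <-> exists2 w, L w & sval p = msum x w.
Proof.
move=> lL Lu k.
pose K : set (points M) := [set msum x w | w in L].
have al : @alines A (@trace M H K).
  exists K => //; split; first by left; exists x, L.
  move=> /(_ (msum x u)) KH; apply: k; apply/msum_hyperplane; apply: KH.
  by exists u.
have lP p : @trace M H K p <-> exists2 w, L w & sval p = msum x w.
  by split=> -[w Lw e]; exists w.
by exists (exist _ _ al); split=> //; exists L, u.
Qed.

(* Points x + s and x + t are joined by the trace of x + st; if x <> z, one can
   choose s and t so that x + s and z + t have no summand in common, hence are
   not joined. *)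
Lemma sameleafP_has_leaf (l m : aline A) x z : has_leaf l x -> has_leaf m z ->
  (x = z <-> forall p q, sval l p -> sval m q ->
     exists k : aline A, sval k p /\ sval k q).
Proof.
move=> [L [u [lL Lu xu lP]]] [K [w [lK Kw zw mP]]]; split.
  move=> ? p q /lP[s Ls ps] /mP[t Kt qt]; subst z.
  have xs := affine_msum ps; have xt := affine_msum qt.
  have [J [lJ Js Jt]] : exists J, [/\ lines J, J s & J t].
    have [<-|st] := EM (s = t).
      by exists L; split.
    exists (hull s t); split; [|exact: hull_l|exact: hull_r].
    by apply/linesE; exists s, t.
  have [k [_ kP]] := make_line lJ Js xs.
  by exists k; split; apply/kP; [exists s|exists t].
move=> h; apply: contrapT => xz.
have [s [Ls xs sz _]] := line_avoid z z lL Lu xu.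
have [t [Kt zt tx ts]] := line_avoid x s lK Kw zw.
have [p pE] := msum_affine xs; have [q qE] := msum_affine zt.
have [||k [kp kq]] := h p q.
  by apply/lP; exists s.
  by apply/mP; exists t.
have [J [v [lJ Jv _ kP]]] := leafP k.
move/kP: kp => [a _]; move/kP: kq => [b _].
rewrite pE qE => /msum_inj e1 /msum_inj e2.
by case: e1 => -[e1 e1']; case: e2 => -[e2 e2']; congruence.
Qed.

(** The joining condition of [sameleafP_has_leaf] for the pair [l], [l] mentions no leaf. It holds
    because [x = x], and so it forces any two leaves of [l] to agree. *)
Lemma has_leafE (l : aline A) x : has_leaf l x <-> leaf l = x.
Proof.
split=> [lx|<-]; last exact: leafP.
apply/(sameleafP_has_leaf (leafP l) lx).
exact/(sameleafP_has_leaf lx lx).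
Qed.

(** If [y] is not orthogonal to [x], then [x + y] is affine and [x] plus the line [xy] has a trace
    with leaf [x]. *)
Lemma leaf_surj x : exists l, leaf l = x.
Proof.
have [y xy] := kappa_proper x.
have lL : lines (hull x y).
  by apply/linesE; exists x, y; split=> // e; apply: xy; rewrite e; apply: kappaxx.
have [l [lx _]] := make_line lL (hull_r x y) xy.
by exists l; apply/has_leafE.
Qed.

Section Sat.
Variables (X Y : Type) (e : X -> apoints A) (d : Y -> aline A).

Lemma sat_sameleaf (y z : Y) : sat (sameleaf y z) e d <-> leaf (d y) = leaf (d z).
Proof.
apply: iff_trans (iff_sym (sameleafP_has_leaf (leafP _) (leafP _))).
rewrite /sameleaf /=.
split=> [h p q yp zq|h [p [q [[yp zq]]]]]; last by apply; apply: h.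
by apply: contrapT => hk; apply: h; exists p, q.
Qed.

End Sat.

(** For non-orthogonal leaves [x] and [t], the affine point [x + t] lies on the traces of [x + xt]
    and [t + xt]. Conversely, a common point [x + u = t + w] with [x <> t] has [u = t], so [x + t]
    is affine. *)
Lemma sat_perp X Y (e : X -> apoints A) (d : Y -> aline A) (y z : Y) :
  sat (perp y z) e d <-> kappa (leaf (d y)) (leaf (d z)).
Proof.
apply: (@iff_trans _ (~ exists p l m,
    (sval l p /\ sval m p) /\
    ((leaf l = leaf (d y) /\ leaf m = leaf (d z)) /\ leaf (d y) <> leaf (d z)))).
  split=> h [p [l [m [lmp [[lx mz] xz]]]]]; apply: h; exists p, l, m; split=> //.
    split; first by split; apply/sat_sameleaf.
    by move/sat_sameleaf.
  split; first by split; [move/sat_sameleaf: lx|move/sat_sameleaf: mz].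
  by move=> xz'; apply: xz; apply/sat_sameleaf.
split=> [h|k [p [l [m [[lp mp] [[lx mz] nxz]]]]]].
  apply: contrapT => k; apply: h.
  have [p pE] := msum_affine k.
  set x := leaf (d y) in k pE *; set t := leaf (d z) in k pE *.
  have xt : x <> t by move=> xt; apply: k; rewrite xt; apply: kappaxx.
  have lL : lines (hull x t) by apply/linesE; exists x, t.
  have [l [/has_leafE lx lP]] := make_line lL (hull_r x t) k.
  have [m [/has_leafE mt mP]] := make_line lL (hull_l x t) (fun h => k (kappaC h)).
  exists p, l, m; split; first split=> /=.
  - by apply/lP; exists t => //; apply: hull_r.
  - by apply/mP; exists x; [apply: hull_l|rewrite pE msumC].
  by split; first split.
have [L [_ [_ _ _ lP]]] := leafP l; have [K [_ [_ _ _ mP]]] := leafP m.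
move/lP: lp => [u _ pu]; move/mP: mp => [w _ pw].
have := pu; rewrite pw => /msum_inj[[? _]|[zu _]]; first by congruence.
by apply: (affine_msum pu); rewrite -zu lx mz.
Qed.

Lemma sat_inhull X Y (e : X -> apoints A) (d : Y -> aline A) (y1 y2 y : Y) :
  sat (inhull y1 y2 y) e d <->
  hull (leaf (d y1)) (leaf (d y2)) (leaf (d y)).
Proof.
split=> [/sat_AllL h w|h].
  have [l <-] := leaf_surj w => k1 k2.
  apply/(sat_perp e (oapp d l) (Some y) None).
  by apply: (sat_Imp _ _ _ _).1 (h l) _; split; apply/sat_perp.
apply/sat_AllL => l; apply/sat_Imp => -[/sat_perp k1 /sat_perp k2].
by apply/sat_perp; apply: h.
Qed.

(* With L the line through leaf k1 and leaf k2, the code denotes leaf k0 + L;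
   different leaves of k0 and k3 flag the line 2L instead. *)
Definition decode_line (k0 k1 k2 k3 : aline A) : set (points M) :=
  let L := hull (leaf k1) (leaf k2) in
  if `[< leaf k0 = leaf k3 >] then [set msum (leaf k0) y | y in L]
  else [set msum y y | y in L].

Lemma sat_oncode X Y (e : X -> apoints A) (d : Y -> aline A) a b k0 k1 k2 k3 :
  sat (oncode a b k0 k1 k2 k3) e d <->
  decode_line (d k0) (d k1) (d k2) (d k3) (msum (leaf (d a)) (leaf (d b))).
Proof.
rewrite /decode_line /oncode (propext (sat_Or _ _ _ _)) !sat_And.
rewrite (propext (sat_Or _ _ _ _)) !sat_And sat_Not.
rewrite !(propext (sat_sameleaf _ _ _ _)) !(propext (sat_inhull _ _ _ _ _)).
case: asboolP => k; split.
- case=> [[_ [[e1 h]|[e1 h]]]|[//]].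
    by exists (leaf (d b)); rewrite // e1.
  by exists (leaf (d a)); rewrite // e1 msumC.
- move=> [y hy /msum_inj[[e1 e2]|[e1 e2]]]; subst y; left; split=> //.
    by left.
  by right.
- by case=> [[//]|[_ [e1 h]]]; exists (leaf (d a)); rewrite // -e1.
- move=> [y hy /msum_inj ye]; right; split=> //.
  have [e1 e2] : y = leaf (d a) /\ y = leaf (d b) by case: ye => -[].
  by rewrite -e1 -e2.
Qed.

Local Notation o n i := (@Ordinal n i isT).

(* An improper point is coded by two affine lines: it is the sum of their leaves. *)
Definition recovery_scheme : scheme := @Scheme 0 2
  (perp (o 2 0) (o 2 1))
  (Or (And (sameleaf (inl (o 2 0)) (inr (o 2 0)))
           (sameleaf (inl (o 2 1)) (inr (o 2 1))))
      (And (sameleaf (inl (o 2 0)) (inr (o 2 1)))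
           (sameleaf (inl (o 2 1)) (inr (o 2 0)))))
  0 4
  (Not (sameleaf (o 4 1) (o 4 2)))
  (AllL (AllL (let v i := Some (Some i) in Iff
     (oncode None (Some None) (v (inl (o 4 0))) (v (inl (o 4 1)))
        (v (inl (o 4 2))) (v (inl (o 4 3))))
     (oncode None (Some None) (v (inr (o 4 0))) (v (inr (o 4 1)))
        (v (inr (o 4 2))) (v (inr (o 4 3)))))))
  (let v i := Some (Some i) in ExL (ExL (And
     (And (Inc None None) (Inc None (Some None)))
     (And (Not (sameleaf None (Some None)))
        (oncode None (Some None) (v (o 4 0)) (v (o 4 1)) (v (o 4 2))
           (v (o 4 3)))))))
  (oncode (inl (o 2 0)) (inl (o 2 1)) (inr (o 4 0)) (inr (o 4 1))
     (inr (o 4 2)) (inr (o 4 3))).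

Lemma veronese_msum (p : points M) : exists x y, p = msum x y.
Proof.
case: p => m hm; have /asboolP[x [y e]] := hm; exists x, y.
exact: val_inj.
Qed.

(** Each leaf is a summand of [p], and distinct leaves exhaust both summands. This lets formulas
    name a proper point by two affine lines through it. *)
Lemma affine_leaves (p : apoints A) (a b : aline A) :
  sval a p -> sval b p -> leaf a <> leaf b -> sval p = msum (leaf a) (leaf b).
Proof.
have [L [_ [_ _ _ lP]]] := leafP a; have [K [_ [_ _ _ mP]]] := leafP b.
move=> /lP[u _ pu] /mP[w _ pw] ab.
by move: (pu); rewrite pw => /msum_inj[[/esym//]|[_ ->]]; apply: msumC.
Qed.

Lemma leaves_of_affine (p : apoints A) : exists a b : aline A,
  [/\ sval a p, sval b p & leaf a <> leaf b].
Proof.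
have [x [y e]] := veronese_msum (sval p); have k := affine_msum e.
have xy : x <> y by move=> xy; apply: k; rewrite xy; apply: kappaxx.
have lL : lines (hull x y) by apply/linesE; exists x, y.
have [l [/has_leafE lx lP]] := make_line lL (hull_r x y) k.
have [m [/has_leafE my mP]] := make_line lL (hull_l x y) (fun h => k (kappaC h)).
exists l, m; split; last by rewrite lx my.
- by apply/lP; exists y => //; apply: hull_r.
- by apply/mP; exists x; [apply: hull_l|rewrite e msumC].
Qed.

Theorem veronese_recovered : definable_in_affine_reduct H.
Proof.
exists recovery_scheme.
(* Codes consist of affine lines only, so their point part is the empty assignment. *)
have e0 : 'I_0 -> apoints A by case.
pose f (c : code A 0 2) : points M := msum (leaf (c.2 (o 2 0))) (leaf (c.2 (o 2 1))).
pose g (d : code A 0 4) :=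
  decode_line (d.2 (o 4 0)) (d.2 (o 4 1)) (d.2 (o 4 2)) (d.2 (o 4 3)).
exists f, g; split.
- apply/seteqP; split=> [p [c /sat_perp k <-]|p]; first exact/msum_hyperplane.
  have [x [y ->]] := veronese_msum p; move/msum_hyperplane.
  have [a <-] := leaf_surj x; have [b <-] := leaf_surj y => k.
  exists (e0, fun i : 'I_2 => nth a [:: a; b] i) => //.
  exact/sat_perp.
- apply/seteqP; split=> [K [d nd <-]|K].
    have nd' : leaf (d.2 (o 4 1)) <> leaf (d.2 (o 4 2)).
      by move=> h; apply: nd; apply/sat_sameleaf.
    have lL : lines (hull (leaf (d.2 (o 4 1))) (leaf (d.2 (o 4 2)))).
      by apply/linesE; do 2 eexists; split; first exact: nd'.
    rewrite /g /decode_line; case: asboolP => _; [left|right].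
      by do 2 eexists; first exact: lL.
    by eexists; first exact: lL.
  have codeE k0 k1 k2 k3 : leaf k1 <> leaf k2 ->
      (g @` [set d | sat1 (ln_dom recovery_scheme) d]) (decode_line k0 k1 k2 k3).
    move=> n; exists (e0, fun i : 'I_4 => nth k0 [:: k0; k1; k2; k3] i) => //.
    by move/sat_sameleaf.
  case=> [[x [L /linesE[y [z [yz ->]]] ->]]|[L /linesE[y [z [yz ->]]] ->]].
    have [k0 k0x] := leaf_surj x; have [k1 k1y] := leaf_surj y.
    have [k2 k2z] := leaf_surj z.
    (* Repeating [k0] as last entry makes the flag select [x + L]. *)
    have := codeE k0 k1 k2 k0; rewrite /decode_line k0x k1y k2z.
    by rewrite asboolT //; apply.
  have [k1 k1y] := leaf_surj y; have [k2 k2z] := leaf_surj z.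
  (* First and last entries have the distinct leaves [y] and [z], so the flag selects [2L]. *)
  have := codeE k1 k1 k2 k2; rewrite /decode_line k1y k2z.
  by rewrite asboolF //; apply.
- split=> [c c' _ _|d d' _ _].
    cbv beta iota delta [sat2 ip_eq recovery_scheme].
    rewrite (propext (sat_Or _ _ _ _)) !sat_And.
    rewrite !(propext (sat_sameleaf _ _ _ _)).
    exact: msum_inj.
  cbv beta iota delta [sat2 ln_eq recovery_scheme].
  rewrite (propext (sat_AllL _ _ _)).
  (* Coded lines are compared pointwise: every point of [M] is a sum of two leaves, so pairs of
     affine lines run through all points. *)
  apply: (@iff_trans _ (forall a b,
    g d (msum (leaf b) (leaf a)) <-> g d' (msum (leaf b) (leaf a)))).
    split=> [-> //|h]; apply/seteqP.
    by split=> p; have [x [y ->]] := veronese_msum p;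
      have [a <-] := leaf_surj x; have [b <-] := leaf_surj y => /h.
  split=> [h a|h a b].
    apply/sat_AllL => b; apply/sat_Iff.
    rewrite !(propext (sat_oncode _ _ _ _ _ _ _ _)); exact: h.
  move/sat_AllL/(_ b)/sat_Iff: (h a).
  by rewrite !(propext (sat_oncode _ _ _ _ _ _ _ _)).
- move=> p d _; cbv beta iota delta [proper_inc recovery_scheme].
  (* Any two affine lines through [p] with distinct leaves have leaf sum [p], so the choice of the
     pair is immaterial. *)
  apply: (@iff_trans _ (exists a b : aline A, (sval b p /\ sval a p) /\
      (leaf b <> leaf a /\ g d (msum (leaf b) (leaf a))))).
    split=> [gp|[a [b [[bp ap] [ba gp]]]]].
      have [a [b [ap bp ab]]] := leaves_of_affine p.
      by exists b, a; rewrite -(affine_leaves ap bp ab).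
    by rewrite (affine_leaves bp ap ba).
  apply: sat_ExL => a; apply: sat_ExL => b; rewrite !sat_And.
  rewrite (propext (sat_oncode _ _ _ _ _ _ _ _)) sat_Not.
  by rewrite (propext (sat_sameleaf _ _ _ _)).
- move=> c d _ _; cbv beta iota delta [sat2 improper_inc recovery_scheme].
  by rewrite (propext (sat_oncode _ _ _ _ _ _ _ _)).
Qed.

End Geometry.

(** * Linear algebra: lines are double perps, and they have enough points *)

Section LinearAlgebra.
Variables (F : fieldType) (V : lmodType F).
Implicit Types u v w : V.

Lemma ptP (p : proj_point V) : exists v (v0 : v != 0), p = pt v0.
Proof.
case: p => U hU; have /asboolP[v v0 e] := hU; exists v, v0.
exact: val_inj.
Qed.

Lemma pt_eqP v w (v0 : v != 0) (w0 : w != 0) :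
  pt v0 = pt w0 <-> exists c, v = c *: w.
Proof.
split=> [/(congr1 val)/= e|[c e]].
  have : span1 v v by exists 1; rewrite ?scale1r.
  by rewrite e => -[c _ <-]; exists c.
apply: val_inj => /=; have c0 : c != 0.
  by apply: contra v0 => /eqP c0; rewrite e c0 scale0r.
apply/seteqP; split=> u [a _ <-]; first by exists (a * c); rewrite // e scalerA.
by exists (a / c); rewrite // e scalerA divfK.
Qed.

Lemma pt_subset_span2 v (v0 : v != 0) u w :
  sval (pt v0) `<=` span2 u w <-> span2 u w v.
Proof.
split=> [|[a [b e]] x [c _ <-]].
  by apply; exists 1; rewrite ?scale1r.
by exists (c * a), (c * b); rewrite e scalerDr !scalerA.
Qed.

Lemma independent2P u v (u0 : u != 0) (v0 : v != 0) :
  independent2 u v <-> pt u0 <> pt v0.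
Proof.
split=> [ind /pt_eqP[c e]|ne a b e].
  have [] := ind 1 (- c); first by rewrite scale1r scaleNr -e subrr.
  by move/eqP; rewrite oner_eq0.
have a0 : a = 0.
  apply/eqP/negP => /negP a0; apply: ne; apply/pt_eqP; exists (- (a^-1 * b)).
  move/eqP: e; rewrite addr_eq0 => /eqP e.
  by rewrite scaleNr -scalerA -scalerN -e scalerA mulVf // scale1r.
split=> //; move/eqP: e; rewrite a0 scale0r add0r scaler_eq0 (negPf v0) orbF.
by move/eqP.
Qed.

Lemma independent2_neq0 u v : independent2 u v -> u != 0 /\ v != 0.
Proof.
move=> ind; split; apply/eqP => e.
  have [] := ind 1 0; first by rewrite e scaler0 scale0r addr0.
  by move/eqP; rewrite oner_eq0.
have [] := ind 0 1; first by rewrite e scaler0 scale0r addr0.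
by move=> _ /eqP; rewrite oner_eq0.
Qed.

Variables (theta : {rmorphism F -> F}) (theta_bij : bijective theta).
Variable xi : {bilinear V -> V -> F | *%R & theta \; *%R}.

Lemma formZr a u v : xi u (a *: v) = theta a * xi u v.
Proof. exact: linearZr_LR. Qed.

Lemma formZl a u v : xi (a *: u) v = a * xi u v.
Proof. exact: linearZl_LR. Qed.

Hypothesis xi_nondeg : nondegenerate_form xi.

Lemma nondegenerate_neq0 v : v != 0 -> exists u, xi u v = 1.
Proof.
move=> v0; have [u k] : exists u, xi u v <> 0.
  apply: contrapT => h; move/eqP: v0; apply; apply: xi_nondeg => u.
  by apply: contrapT => k; apply: h; exists u.
by exists ((xi u v)^-1 *: u); rewrite formZl mulVf //; apply/eqP.
Qed.

(** Gram-Schmidt in any dimension: [w1], [w2'] are made dual to [x], [y'], and [z'] is [z] without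
    its components along [x] and [y']. Every [w] is a combination of [w1], [w2'] and some [w']
    orthogonal to [x] and [y]; all three annihilate [z'], so nondegeneracy gives [z' = 0]. *)
Lemma span2_biperp x y z : independent2 x y ->
  (forall w, xi w x = 0 -> xi w y = 0 -> xi w z = 0) -> span2 x y z.
Proof.
move=> ind h; case: (theta_bij) => t tK Kt.
have [x0 y0] := independent2_neq0 ind.
have [w1 w1x] := nondegenerate_neq0 x0.
(* Scalars leave the second argument through [theta], so coefficients there are taken through its
   inverse [t]. *)
pose b := t (xi w1 y); pose y' := y - b *: x.
have y'0 : y' != 0.
  apply/eqP => e; have [] := ind (- b) 1; first by rewrite scale1r scaleNr addrC.
  by move=> _ /eqP; rewrite oner_eq0.
have w1y' : xi w1 y' = 0 by rewrite linearBr /= formZr w1x Kt mulr1 subrr.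
have [w2 w2y'] := nondegenerate_neq0 y'0.
pose c := t (xi w1 z); pose w2' := w2 - xi w2 x *: w1.
pose e := t (xi w2' (z - c *: x)).
pose z' := z - c *: x - e *: y'.
have w2'x : xi w2' x = 0 by rewrite linearBl /= formZl w1x mulr1 subrr.
have w2'y' : xi w2' y' = 1 by rewrite linearBl /= formZl w1y' mulr0 subr0.
suff z'0 : z' = 0.
  exists (c - e * b), e; move/eqP: z'0.
  rewrite /z' /y' scalerBr scalerA !subr_eq add0r => /eqP ->.
  by rewrite scalerBl addrC addrCA addrA [RHS]addrC addrA.
apply: xi_nondeg => w; pose w' := w - xi w x *: w1 - xi w y' *: w2'.
have w'x : xi w' x = 0.
  by rewrite !linearBl /= !formZl w1x w2'x mulr1 mulr0 subr0 subrr.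
have w'y' : xi w' y' = 0.
  by rewrite !linearBl /= !formZl w1y' w2'y' mulr1 mulr0 subr0 subrr.
have w'y : xi w' y = 0.
  by move: w'y'; rewrite linearBr /= formZr w'x mulr0 subr0.
have w'z' : xi w' z' = 0.
  by rewrite !linearBr /= !formZr w'x w'y' (h _ w'x w'y) !mulr0 !subr0.
have w1z' : xi w1 z' = 0.
  by rewrite !linearBr /= !formZr w1x w1y' mulr0 mulr1 Kt subr0 subrr.
have w2'z' : xi w2' z' = 0.
  by rewrite linearBr /= formZr w2'y' mulr1 Kt subrr.
move: w'z'; rewrite !linearBl /= !formZl w1z' w2'z' !mulr0 !subr0.
by [].
Qed.

Hypothesis xi_refl : reflexive_form xi.
Variable kappa : points (proj_space V) -> set (points (proj_space V)).
Hypothesis kappa_xi : induced_by xi kappa.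

Lemma kappaP v u (v0 : v != 0) (u0 : u != 0) :
  kappa (pt v0) (pt u0) <-> xi v u = 0.
Proof. by split=> [/kappa_xi/xi_refl//|/xi_refl/kappa_xi]. Qed.

Lemma form_symmetric p q : kappa p q -> kappa q p.
Proof.
have [v [v0 ->]] := ptP p; have [w [w0 ->]] := ptP q.
by move=> /kappaP/xi_refl/kappaP.
Qed.

Lemma form_proper p : exists q, ~ kappa p q.
Proof.
have [v [v0 ->]] := ptP p.
have [u uv] := nondegenerate_neq0 v0.
have u0 : u != 0.
  apply/eqP => u0; move/eqP: uv; rewrite u0 linear0l eq_sym.
  by rewrite oner_eq0.
by exists (pt u0) => /kappa_xi; rewrite uv => /eqP; rewrite oner_eq0.
Qed.

Lemma hull_pt u v (u0 : u != 0) (v0 : v != 0) : pt u0 <> pt v0 ->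
  hull kappa (pt u0) (pt v0) = [set p | sval p `<=` span2 u v].
Proof.
move=> /independent2P ind; apply/seteqP; split=> p; have [w [w0 ->]] := ptP p.
  move=> h; apply/pt_subset_span2; apply: span2_biperp => // t tu tv.
  (* The zero vector spans no point, so [kappa] says nothing about it. *)
  have [->|t0] := eqVneq t 0; first exact: linear0l.
  by apply/(kappa_xi w0 t0); apply: h; apply/kappa_xi.
move=> /pt_subset_span2[a [b e]] q; have [t [t0 ->]] := ptP q.
move=> /kappa_xi tu /kappa_xi tv; apply/kappa_xi.
by rewrite e linearDr /= !formZr tu tv !mulr0 addr0.
Qed.

Lemma proj_linesE (L : set (points (proj_space V))) :
  lines L <-> exists x y, x <> y /\ L = hull kappa x y.
Proof.
split=> [[W [u [v [ind ->]]] ->]|[x [y [xy ->]]]].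
  have [u0 v0] := independent2_neq0 ind.
  have uv : pt u0 <> pt v0 by apply/independent2P.
  by exists (pt u0), (pt v0); split=> //; rewrite hull_pt.
move: xy; have [u [u0 ->]] := ptP x; have [v [v0 ->]] := ptP y => uv.
rewrite hull_pt //; exists (span2 u v) => //.
by exists u, v; split=> //; apply/independent2P.
Qed.

Hypothesis charF : 2%N \notin [pchar F].

(* If <u1> on L is orthogonal to x and <u> on L is not, then <u>, <u + u1> and
   <u - u1> are distinct because 2 <> 0, and none of them is orthogonal to x. *)
Lemma proj_line_avoid (L : set (points (proj_space V)))
    (x p a b : points (proj_space V)) :
  lines L -> L p -> ~ kappa x p ->
  exists q, [/\ L q, ~ kappa x q, q <> a & q <> b].
Proof.
case=> W [s [t [ind ->]]] -> /=.
have [u [u0 ->]] := ptP p; have [v [v0 ->]] := ptP x.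
move=> /pt_subset_span2[c [d ue]] /kappa_xi uv.
(* The combination of [s] and [t] orthogonal to [v]; it is nonzero, as otherwise the whole line
   would be orthogonal to [v]. *)
pose u1 := xi t v *: s - xi s v *: t.
have u1v : xi u1 v = 0 by rewrite linearBl /= !formZl mulrC subrr.
have u10 : u1 != 0.
  apply/eqP => e; have [] := ind (xi t v) (- xi s v); first by rewrite scaleNr.
  move=> tv /eqP; rewrite oppr_eq0 => /eqP sv; apply: uv.
  by rewrite ue linearDl /= !formZl tv sv !mulr0 addr0.
have qv k : xi (u + k *: u1) v = xi u v.
  by rewrite linearDl /= formZl u1v mulr0 addr0.
have q0 k : u + k *: u1 != 0.
  by apply/eqP => e; apply: uv; rewrite -(qv k) e linear0l.
(* Applying [xi] against [v] to proportional representatives shows that their factor is 1. *)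
have q_inj k l : pt (q0 k) = pt (q0 l) -> k = l.
  move/pt_eqP => [r e]; have rv := congr1 (xi^~ v) e.
  have r1 : r = 1.
    by apply: (mulIf (introN eqP uv)); rewrite mul1r -{1}(qv l) -formZl -rv qv.
  move: e; rewrite r1 scale1r => /addrI/eqP.
  by rewrite -subr_eq0 -scalerBl scaler_eq0 (negPf u10) orbF subr_eq0 => /eqP.
have qP k : sval (pt (q0 k)) `<=` span2 s t /\ ~ kappa (pt v0) (pt (q0 k)).
  split; last by move/kappa_xi; rewrite qv.
  apply/pt_subset_span2; exists (c + k * xi t v), (d - k * xi s v).
  by rewrite ue scalerBr !scalerA scalerDl scalerBl addrACA.
have two0 : (2%:R : F) != 0 by move: charF; rewrite inE.
have n01 : (0 : F) <> 1 by move/esym/eqP; rewrite oner_eq0.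
have n1N : (1 : F) <> -1.
  by move/eqP; rewrite -subr_eq0 opprK => /eqP e; move/eqP: two0; apply.
have n0N : (0 : F) <> -1 by move/eqP; rewrite eq_sym oppr_eq0 oner_eq0.
apply: contrapT => h.
have bad k : pt (q0 k) = a \/ pt (q0 k) = b.
  apply: contrapT => /not_orP[ka kb]; apply: h.
  by have [? ?] := qP k; exists (pt (q0 k)).
(* Pigeonhole: three distinct points cannot all lie in [{a, b}]. *)
have := (q_inj 0 1, q_inj 1 (-1), q_inj 0 (-1)).
case: (bad 0) (bad 1) (bad (-1)) => -> [] -> [] -> [[i1 i2] i3];
  by [case: n01; apply: i1|case: n1N; apply: i2|case: n0N; apply: i3].
Qed.

End LinearAlgebra.

Theorem theorem2p17 (F : fieldType) (V : lmodType F)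
    (charF : 2%N \notin [pchar F])
    (theta : {rmorphism F -> F}) (theta_bij : bijective theta)
    (xi : {bilinear V -> V -> F | *%R & theta \; *%R})
    (xi_refl : reflexive_form xi) (xi_neq0 : nonzero_form xi)
    (xi_nondeg : nondegenerate_form xi)
    (kappa : points (proj_space V) -> set (points (proj_space V)))
    (kappa_xi : induced_by xi kappa) (kappa_sympl : symplectic kappa) :
  definable_in_affine_reduct (M := veronese (proj_space V)) (hyperplane_of kappa).
Proof.
apply: veronese_recovered => //.
- exact: form_symmetric xi_refl _ kappa_xi.
- exact: form_proper xi_nondeg _ kappa_xi.
- exact: proj_linesE theta_bij _ xi_nondeg _ kappa_xi.
- exact: proj_line_avoid kappa_xi charF.
Qed.
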